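(* Let $k,s\ge 1$ be integers with $ks\ge 2$, and let $G$ be a graph of order $p$ and size $q$ with $d\ge 0$ pendant edges. Consider the following conditions: (a) $\chi_{lt}(G)=t=\Delta(G)+1$, and a corresponding local total antimagic labeling $f$ of $G$ (one inducing exactly $t$ distinct weights) assigns $k$ to a maximum degree vertex $v$ of $G$; (b) $w_f(v)+\sum_{j=1}^{s}\sum_{i=1}^{k}(p+q+2jk+1-i)\ne w_f(x)$ for each vertex $x$ adjacent to $v$ in $G$; (c) $v$ is the only element of $V(G)\cup E(G)$ with weight $w_f(v)$, or else there is an element of $V(G)\cup E(G)$ that is not a pendant vertex and whose weight under $f$ is in $\{p+q+(2j-1)k+i \mid 1\le j\le s,\ 1\le i\le k\}$. Let $G_v(k,s)$ be the graph obtained from $G$ by attaching $ks$ pendant edges to $v$. If conditions (a) and (b) are satisfied, then $$\Delta(G_v(k,s))+1\le \chi_{lt}(G_v(k,s))\le \Delta(G_v(k,s))+2 .$$ If condition (c) is also satisfied, then the lower bound is attained, i.e. $\chi_{lt}(G_v(k,s))=\Delta(G_v(k,s))+1$.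
   Context: All graphs $G$ are finite, simple and loopless, of order $p=|V(G)|\ge 3$ and size $q=|E(G)|\ge 2$, with no isolated vertex and no $K_2$ component (graphs may be disconnected). $\Delta(G)$ is the maximum degree. A pendant vertex is a vertex of degree 1; a pendant edge is an edge incident to a pendant vertex. Attaching $r$ pendant edges to $v$ means adding $r$ new vertices, each joined only to $v$. A local total antimagic labeling of $G=(V,E)$ is a bijection $f:V\cup E\to\{1,\dots,p+q\}$ such that, with weights $w_f(u)=\sum f(e)$ over all edges $e$ incident to $u$ for $u\in V$ (the label of $u$ itself is not included) and $w_f(uv)=f(u)+f(v)$ for $uv\in E$, one has: adjacent vertices have distinct weights, adjacent edges have distinct weights, and every vertex has a weight distinct from that of each of its incident edges. $\chi_{lt}(G)$ is the minimum, over all local total antimagic labelings $f$ of $G$, of the number of distinct values among all the vertex and edge weights. *)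

(* Defs.v *)
From mathcomp Require Import all_boot.

Set Implicit Arguments.
Unset Strict Implicit.
Unset Printing Implicit Defensive.

Record sgraph := SGraph {
  vertex :> finType;
  adj : rel vertex;
  adj_sym : symmetric adj;
  adj_irrefl : irreflexive adj }.

Section Graph.
Variable G : sgraph.
Implicit Types (u v : G).

Definition is_edge (A : {set G}) : bool :=
  [exists u, exists v, adj u v && (A == [set u; v])].

Definition edge : finType := {A : {set G} | is_edge A}.

(* The disjoint union of V(G) and E(G): [inl u] is a vertex, [inr A] an edge. *)
Definition elem : finType := (G + edge)%type.

Definition gorder : nat := #|{: G}|.
Definition gsize : nat := #|{: edge}|.

Definition degree u : nat := #|[set v | adj u v]|.
Definition max_degree : nat := \max_u degree u.

Definition pendant u : bool := degree u == 1.
Definition pendant_edges : {set edge} :=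
  [set A : edge | [exists u in val A, pendant u]].

Definition is_pendant_vertex (x : elem) : bool :=
  if x is inl u then pendant u else false.

Definition component u : {set G} := [set v | connect (@adj G) u v].

Definition no_isolated_vertex : Prop := forall u, 0 < degree u.
Definition no_K2_component : Prop :=
  forall u v, adj u v -> component u <> [set u; v].

Definition admissible : Prop :=
  [/\ 3 <= gorder, 2 <= gsize, no_isolated_vertex & no_K2_component].

(* The codomain is {0, ..., p + q}; [is_labeling] excludes the value 0. *)
Definition labeling := {ffun elem -> 'I_(gorder + gsize).+1}.

Definition is_labeling (f : labeling) : bool :=
  injectiveb f && (f @: [set: elem] == [set i | 0 < nat_of_ord i]).

Definition weight (f : labeling) (x : elem) : nat :=
  match x with
  | inl u => \sum_(A : edge | u \in val A) f (inr A)
  | inr A => \sum_(u in val A) f (inl u)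
  end.

Definition local_total_antimagic (f : labeling) : bool :=
  [&& is_labeling f,
      [forall u : G, forall v : G,
         adj u v ==> (weight f (inl u) != weight f (inl v))],
      [forall A : edge, forall B : edge,
         (A != B) && (val A :&: val B != set0)
           ==> (weight f (inr A) != weight f (inr B))]
    & [forall u : G, forall A : edge,
         (u \in val A) ==> (weight f (inl u) != weight f (inr A))]].

Definition num_weights (f : labeling) : nat :=
  size (undup [seq weight f x | x : elem]).

(* If G has no local total antimagic labeling the value is 0, which is not
   the number of weights of any labeling of a nonempty graph. *)
Definition chi_lt : nat :=
  if [pick f | local_total_antimagic f] is Some f0
  then num_weights [arg min_(f < f0 | local_total_antimagic f) num_weights f]
  else 0.

End Graph.

Section Attach.
Variables (G : sgraph) (v : G) (n : nat).

Definition attach_adj (x y : G + 'I_n) : bool :=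
  match x, y with
  | inl a, inl b => adj a b
  | inl a, inr _ => a == v
  | inr _, inl b => b == v
  | inr _, inr _ => false
  end.

Lemma attach_adj_sym : symmetric attach_adj.
Proof. by case=> [a|i] [b|j] //=; exact: adj_sym. Qed.

Lemma attach_adj_irrefl : irreflexive attach_adj.
Proof. by case=> [a|i] //=; exact: adj_irrefl. Qed.

(* G with n pendant edges attached to v. *)
Definition attach_pendant : sgraph := SGraph attach_adj_sym attach_adj_irrefl.

End Attach.

(* Main.v *)
(* Write [n = k * s]. The [2n] new labels are split into [2s] runs of length [k]:
   even runs go to the new pendant vertices, odd runs to the new edges. As [v]
   has label [k], the new edges get as weights the labels of the odd runs, which
   are also the weights of the new pendant vertices, so only [n] new weights
   appear there; besides, only the weight of [v] changes. Hence at most [n + 1]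
   weights are added, and under (c) one old weight disappears or is among those
   [n]. The lower bound holds because a vertex and its incident edges have
   pairwise distinct weights. *)

Require Import Defs.
From mathcomp Require Import all_boot.
From mathcomp Require Import zify.

Set Implicit Arguments.
Unset Strict Implicit.
Unset Printing Implicit Defensive.

(** * Edges, labels and weights in a fixed graph; the degree bound on [chi_lt] *)

Section LocalTotalAntimagic.
Variable G : sgraph.
Implicit Types (u v x : G) (A B : edge G) (f : labeling G).

Lemma adj_neq u v : adj u v -> u != v.
Proof. by apply: contraTneq => ->; rewrite adj_irrefl. Qed.

Lemma adj_is_edge u v : adj u v -> is_edge [set u; v].
Proof. by move=> uv; apply/existsP; exists u; apply/existsP; exists v; rewrite uv eqxx. Qed.

Definition adj_edge u v (uv : adj u v) : edge G := Sub [set u; v] (adj_is_edge uv).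

Lemma val_adj_edge u v (uv : adj u v) : val (adj_edge uv) = [set u; v].
Proof. by []. Qed.

Lemma edgeP A : exists u v, adj u v /\ val A = [set u; v].
Proof.
by case/existsP: (valP A) => u /existsP[v /andP[uv /eqP eA]]; exists u, v.
Qed.

Lemma weight_adj_edge f u v (uv : adj u v) :
  weight f (inr (adj_edge uv)) = f (inl u) + f (inl v).
Proof.
by rewrite /weight val_adj_edge big_setU1 ?big_set1 // inE adj_neq.
Qed.

Lemma labeling_inj f : is_labeling f -> injective f.
Proof. by case/andP=> /injectiveP. Qed.

Lemma label_gt0 f y : is_labeling f -> 0 < f y.
Proof.
case/andP=> _ /eqP/setP/(_ (f y)).
by rewrite inE imset_f ?inE // => <-.
Qed.

Lemma label_le f y : f y <= gorder G + gsize G.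
Proof. by rewrite -ltnS. Qed.

(** The other endpoint has a label of at most [gorder G + gsize G]. Applied at [v], whose label is
    [k], this keeps the weights of the old edges at [v] below every [high i]. *)
Lemma weight_adj_edge_le f u A :
  u \in val A -> weight f (inr A) <= f (inl u) + (gorder G + gsize G).
Proof.
have [a [b [ab eA]]] := edgeP A.
rewrite /= eA big_setU1 ?inE ?adj_neq // big_set1 => uab.
have := label_le f (inl a); have := label_le f (inl b).
by case/orP: uab => /eqP-> /=; lia.
Qed.

Lemma lta_labeling f : local_total_antimagic f -> is_labeling f.
Proof. by case/and4P. Qed.

Lemma lta_vertices f u v : local_total_antimagic f ->
  adj u v -> weight f (inl u) != weight f (inl v).
Proof. by case/and4P=> _ /forallP/(_ u)/forallP/(_ v)/implyP. Qed.

Lemma lta_edges f A B u : local_total_antimagic f -> A != B ->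
  u \in val A -> u \in val B -> weight f (inr A) != weight f (inr B).
Proof.
case/and4P=> _ _ /forallP/(_ A)/forallP/(_ B)/implyP h _ AB uA uB.
by apply: h; rewrite AB; apply/set0Pn; exists u; rewrite inE uA.
Qed.

Lemma lta_incident f u A : local_total_antimagic f ->
  u \in val A -> weight f (inl u) != weight f (inr A).
Proof. by case/and4P=> _ _ _ /forallP/(_ u)/forallP/(_ A)/implyP. Qed.

Lemma mem_weights f y : weight f y \in undup [seq weight f x | x : elem G].
Proof. by rewrite mem_undup; apply: image_f. Qed.

Lemma num_weights_le f (s : seq nat) :
  (forall y, weight f y \in s) -> num_weights f <= size s.
Proof.
move=> sub; apply: uniq_leq_size (undup_uniq _) _ => w.
by rewrite mem_undup => /imageP[y _ ->].
Qed.

(* The edges at [v] are pairwise adjacent, so their weights and that of [v]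
   are all distinct. *)
Lemma degree_lt_num_weights f v :
  local_total_antimagic f -> degree v < num_weights f.
Proof.
move=> fP; have inj := labeling_inj (lta_labeling fP).
pose s := [seq (f (inl v) + f (inl x) : nat) | x <- enum [set x | adj v x]].
have -> : degree v = size s by rewrite size_map -cardE.
have sE w : w \in s -> exists2 A : edge G, v \in val A & w = weight f (inr A).
  case/mapP=> x; rewrite mem_enum inE => vx ->.
  by exists (adj_edge vx); rewrite ?weight_adj_edge // val_adj_edge !inE eqxx.
apply: (@uniq_leq_size _ (weight f (inl v) :: s)).
  rewrite cons_uniq map_inj_uniq ?enum_uniq ?andbT.
    by apply/negP=> /sE[A vA] /eqP; apply/negP/lta_incident.
  by move=> x y /addnI/val_inj/inj[].
move=> w; rewrite inE => /orP[/eqP->|/sE[A _ ->]]; exact: mem_weights.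
Qed.

Lemma chi_lt_le f : local_total_antimagic f -> chi_lt G <= num_weights f.
Proof.
rewrite /chi_lt; case: pickP => [f0 f0P|nP fP]; last by rewrite nP in fP.
by case: arg_minnP => // g _ gmin; apply: gmin.
Qed.

Lemma chi_lt_attained f : local_total_antimagic f ->
  exists2 g : labeling G, local_total_antimagic g & chi_lt G = num_weights g.
Proof.
rewrite /chi_lt; case: pickP => [f0 f0P _|nP fP]; last by rewrite nP in fP.
by case: arg_minnP => // g gP _; exists g.
Qed.

(** The labeling [f] rules out the default value 0 of [chi_lt], so the minimum is attained by some
    labeling, to which the degree bound applies. *)
Lemma degree_lt_chi_lt f v : local_total_antimagic f -> degree v < chi_lt G.
Proof.
by case/chi_lt_attained=> g gP ->; apply: degree_lt_num_weights.
Qed.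

End LocalTotalAntimagic.

(** * Edges, order, size and degrees after attaching pendant edges *)

Section AttachPendant.
Variables (G : sgraph) (v : G) (n : nat).
Local Notation Gv := (attach_pendant v n).

Lemma old_edge_proof (B : edge G) :
  is_edge ((@inl G 'I_n) @: val B : {set Gv}).
Proof.
have [a [b [ab ->]]] := edgeP B.
by rewrite imsetU1 imset_set1; apply: (@adj_is_edge Gv).
Qed.

Lemma new_edge_proof (i : 'I_n) : is_edge ([set inl v; inr i] : {set Gv}).
Proof. by apply: (@adj_is_edge Gv) => /=. Qed.

(** One half of a bijection between [edge G + 'I_n] and the edges of [Gv], through which sums and
    case analyses over edges split into old and new ones. *)
Definition attach_edge (e : edge G + 'I_n) : edge Gv :=
  match e with
  | inl B => Sub ((@inl G 'I_n) @: val B : {set Gv}) (old_edge_proof B)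
  | inr i => Sub ([set inl v; inr i] : {set Gv}) (new_edge_proof i)
  end.

Lemma val_old_edge B : val (attach_edge (inl B)) = (@inl G 'I_n) @: val B.
Proof. by []. Qed.

Lemma val_new_edge i : val (attach_edge (inr i)) = [set inl v; inr i].
Proof. by []. Qed.

Lemma old_in_old (u : G) B :
  (inl u \in val (attach_edge (inl B))) = (u \in val B).
Proof. by rewrite val_old_edge mem_imset // => x y []. Qed.

Lemma new_in_old i B : (inr i \in val (attach_edge (inl B))) = false.
Proof. by rewrite val_old_edge; apply/imsetP=> -[]. Qed.

Lemma old_in_new (u : G) i : (inl u \in val (attach_edge (inr i))) = (u == v).
Proof. by rewrite val_new_edge !inE /= orbF. Qed.

Lemma new_in_new i j : (inr i \in val (attach_edge (inr j))) = (i == j).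
Proof. by rewrite val_new_edge !inE. Qed.

Lemma attach_edge_inj : injective attach_edge.
Proof.
move=> [A|i] [B|j] eAB.
- congr inl; apply/val_inj/setP=> u.
  by rewrite -!old_in_old eAB.
- by have := new_in_old j A; rewrite eAB new_in_new eqxx.
- by have := new_in_old i B; rewrite -eAB new_in_new eqxx.
- by congr inr; apply/eqP; rewrite -new_in_new -eAB new_in_new.
Qed.

Lemma attach_edge_codom (A : edge Gv) : A \in codom attach_edge.
Proof.
suff [e eA] : exists e, val A = val (attach_edge e).
  by rewrite (val_inj eA) codom_f.
have [[a|i] [[b|j] [/= ab ->]]] := edgeP A => //.
- by exists (inl (adj_edge ab)); rewrite val_old_edge val_adj_edge imsetU1 imset_set1.
- by exists (inr j); rewrite val_new_edge (eqP ab).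
- by exists (inr i); rewrite val_new_edge (eqP ab) setUC.
Qed.

Definition detach_edge (A : edge Gv) : edge G + 'I_n :=
  iinv (attach_edge_codom A).

Lemma attach_edgeK : cancel attach_edge detach_edge.
Proof. by move=> e; apply: (iinv_f attach_edge_inj). Qed.

Lemma detach_edgeK : cancel detach_edge attach_edge.
Proof. by move=> A; apply: f_iinv. Qed.

Lemma gorder_attach : gorder Gv = gorder G + n.
Proof. by rewrite /gorder card_sum card_ord. Qed.

Lemma gsize_attach : gsize Gv = gsize G + n.
Proof.
rewrite /gsize -(bij_eq_card (Bijective attach_edgeK detach_edgeK)).
by rewrite card_sum card_ord.
Qed.

Lemma degree_old (u : G) : degree (inl u : Gv) = degree u + (u == v) * n.
Proof.
rewrite /degree -sum1_card big_sumType /= -!sum1dep_card.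
congr (_ + _); first by apply: eq_bigl => x; rewrite inE.
rewrite (eq_bigl (fun=> u == v)) => [|i]; last by rewrite inE.
by case: eqP => _; rewrite ?big_pred0_eq // sum1_card card_ord mul1n.
Qed.

Lemma degree_new i : degree (inr i : Gv) = 1.
Proof.
rewrite /degree -(cards1 (inl v : Gv)); congr #|pred_of_set _|.
by apply/setP=> -[x|j]; rewrite !inE.
Qed.

(** Only [v] gains degree among the old vertices, and it was already maximal; the positivity
    condition keeps the new vertices, of degree 1, below it. *)
Lemma max_degree_attach : degree v = max_degree G -> 0 < n + degree v ->
  max_degree Gv = max_degree G + n.
Proof.
move=> vmax pos; apply/eqP; rewrite eqn_leq; apply/andP; split.
  apply/bigmax_leqP=> -[u|i] _; last by rewrite degree_new addnC -vmax.
  rewrite degree_old leq_add ?leq_bigmax //.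
  by case: eqP; rewrite ?mul1n.
rewrite -vmax; apply: leq_trans (leq_bigmax (inl v : Gv)).
by rewrite degree_old eqxx mul1n.
Qed.

End AttachPendant.

(** * Arithmetic of the runs of new labels *)

(* [low] enumerates the even runs above [N] and [high] the odd ones. *)
Section Runs.
Variables (N k : nat).

Definition low (i : nat) : nat := N.+1 + 2 * (i %/ k) * k + i %% k.
Definition high (i : nat) : nat := low i + k.

Hypothesis k_gt0 : 0 < k.

Lemma low_gt i : N < low i.
Proof. by rewrite /low -addnA leq_addr. Qed.

Lemma high_gt i : N + k < high i.
Proof. by rewrite /high ltn_add2r low_gt. Qed.

Lemma high_le s i : i < k * s -> high i <= N + 2 * (k * s).
Proof.
rewrite mulnC -ltn_divLR // => lt_s; have := leq_mul lt_s (leqnn k);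
have := ltn_pmod i k_gt0.
rewrite /high /low mulSn -!mulnA.
move: (i %/ k * k) (i %% k) => a b. lia.
Qed.

Lemma low_le s i : i < k * s -> low i <= N + 2 * (k * s).
Proof. by move/high_le; apply: leq_trans; apply: leq_addr. Qed.

(** Dividing the offset of a label from [N.+1] by [k] recovers the number of its run. *)
Lemma divn_run m i : (m * k + i %% k) %/ k = m.
Proof. by rewrite divnMDl // [_ %% _ %/ _]divn_small ?ltn_pmod ?addn0. Qed.

Lemma low_inj : injective low.
Proof.
move=> i j; rewrite /low -!addnA => /addnI e.
have eq_div : i %/ k = j %/ k.
  by have := congr1 (divn^~ k) e; rewrite /= !divn_run; lia.
by rewrite (divn_eq i k) (divn_eq j k); move: e; rewrite eq_div => /addnI->.
Qed.

Lemma high_inj : injective high.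
Proof. by move=> i j /addIn/low_inj. Qed.

(** The run numbers [2 * (i %/ k)] and [2 * (j %/ k) + 1] differ in parity. *)
Lemma low_neq_high i j : low i <> high j.
Proof.
rewrite /high /low -!addnA => /addnI e; have := congr1 (divn^~ k) e.
by rewrite /= [_ + k]addnC addnA -mulSnr !divn_run; lia.
Qed.

(** Identifies the sum in condition (b) with the total of the odd runs. *)
Lemma sum_high s : \sum_(i < k * s) high i =
  \sum_(1 <= j < s.+1) \sum_(1 <= i < k.+1) (N + 2 * j * k + 1 - i).
Proof.
rewrite -(big_mkord xpredT) mulnC big_nat_mul [RHS]big_add1 /=.
apply: eq_bigr => j _; rewrite -{1}[j * k]add0n mulSn big_addn addnK.
(* Condition (b) lists each run downwards from its top, [high] upwards. *)
rewrite [RHS]big_nat_rev [RHS]big_add1 /= big_nat [RHS]big_nat.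
apply: eq_bigr => i /andP[_ ik].
rewrite /high /low [i + _]addnC divnMDl // modnMDl divn_small // modn_small //.
by nia.
Qed.

(** The weights listed in condition (c) are values of [high]; the witness shifts both indices to
    start from 0. *)
Lemma exists_high s (j i : nat) : 1 <= j <= s -> 1 <= i <= k ->
  exists l : 'I_(k * s), high l = N + (2 * j - 1) * k + i.
Proof.
move=> /andP[j1 js] /andP[i1 ik].
have lt : j.-1 * k + i.-1 < k * s by nia.
exists (Ordinal lt) => /=.
rewrite /high /low divnMDl // modnMDl divn_small ?modn_small; nia.
Qed.

End Runs.

(** * The extended labeling and its bijectivity *)

Section AttachLabeling.
Variables (G : sgraph) (v : G) (k s : nat) (f : labeling G).
Hypotheses (k_gt0 : 0 < k) (ks_gt1 : 1 < k * s).
Hypotheses (f_lta : local_total_antimagic f) (fv : f (inl v) = k :> nat).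

Local Notation n := (k * s).
Local Notation Gv := (attach_pendant v n).
Local Notation N := (gorder G + gsize G).
Local Notation low := (low N k).
Local Notation high := (high N k).

(* Without the cyclic shift [ordS] a pendant vertex and its edge would both have
   weight [high i]. *)
Definition attach_label (x : elem Gv) : nat :=
  match x with
  | inl (inl u) => f (inl u)
  | inl (inr i) => low i
  | inr A => match detach_edge A with
             | inl B => f (inr B)
             | inr i => high (ordS i)
             end
  end.

Lemma attach_label_edge e : attach_label (inr (attach_edge v e)) =
  match e with inl B => f (inr B) : nat | inr i => high (ordS i) end.
Proof. by rewrite /= attach_edgeK. Qed.

Lemma card_attach : gorder Gv + gsize Gv = N + 2 * n.
Proof. by rewrite gorder_attach gsize_attach; lia. Qed.

Lemma attach_label_le x : attach_label x <= gorder Gv + gsize Gv.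
Proof.
rewrite card_attach; case: x => [[u|i]|A] /=.
- by apply: leq_trans (label_le f _) _; apply: leq_addr.
- exact: low_le.
case: detach_edge => [B|i]; last exact: (high_le _ k_gt0 (ltn_ord (ordS i))).
by apply: leq_trans (label_le f _) _; apply: leq_addr.
Qed.

Definition attach_labeling : labeling Gv := [ffun x => inord (attach_label x)].
Local Notation g := attach_labeling.

Lemma attach_labelingE x : g x = attach_label x :> nat.
Proof. by rewrite ffunE inordK ?ltnS ?attach_label_le. Qed.

(** Old labels are at most [N], while [low] and [high] are injective with disjoint ranges above
    [N]. *)
Lemma attach_label_inj : injective attach_label.
Proof.
have f_inj := labeling_inj (lta_labeling f_lta).
have old_lt y i : (f y : nat) <> low i.
  by have := label_le f y; have := low_gt N k i; lia.
have old_lt' y i : (f y : nat) <> high i.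
  by have := label_le f y; have := high_gt N k i; lia.
have lowI i j : low i = low j -> i = j by exact: low_inj.
have highI i j : high i = high j -> i = j by exact: high_inj.
have lh i j : low i <> high j by exact: low_neq_high.
move=> [x|A] [y|B].
- case: x y => [u|i] [w|j] //=.
  + by move/val_inj/f_inj=> [->].
  + by move/old_lt.
  + by move/esym/old_lt.
  + by move/lowI/val_inj=> ->.
- rewrite -(detach_edgeK B) attach_label_edge; case: x (detach_edge B) => [u|i] [C|j] /=.
  + by move/val_inj/f_inj.
  + by move/old_lt'.
  + by move/esym/old_lt.
  + by move/lh.
- rewrite -(detach_edgeK A) attach_label_edge; case: y (detach_edge A) => [u|i] [C|j] /=.
  + by move/val_inj/f_inj.
  + by move/esym/old_lt'.
  + by move/old_lt.
  + by move/esym/lh.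
- rewrite -(detach_edgeK A) -(detach_edgeK B) !attach_label_edge.
  case: (detach_edge A) (detach_edge B) => [C|i] [D|j].
  + by move/val_inj/f_inj=> [->].
  + by move/old_lt'.
  + by move/esym/old_lt'.
  + by move/highI/val_inj/(bij_inj (@ordS_bij _))=> ->.
Qed.

Lemma attach_label_gt0 x : 0 < attach_label x.
Proof.
have lab_gt0 y := label_gt0 y (lta_labeling f_lta).
by case: x => [[u|i]|A] //=; case: detach_edge.
Qed.

Lemma attach_is_labeling : is_labeling g.
Proof.
have g_inj : injective g.
  by move=> x y /(congr1 val); rewrite /= !attach_labelingE; apply: attach_label_inj.
apply/andP; split; first exact/injectiveP.
(* By injectivity, it suffices that all labels are positive and that the cardinalities agree. *)
rewrite eqEcard; apply/andP; split.
  by apply/subsetP=> _ /imsetP[x _ ->]; rewrite inE attach_labelingE attach_label_gt0.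
rewrite (card_imset _ g_inj) cardsT card_sum -/(gorder Gv) -/(gsize Gv).
have -> : [set i : 'I_(gorder Gv + gsize Gv).+1 | 0 < i] = [set~ ord0].
  by apply/setP=> i; rewrite !inE -val_eqE /= lt0n.
by rewrite cardsC1 card_ord.
Qed.

(** * Weights under the extended labeling *)

Lemma weight_old_edge B : weight g (inr (attach_edge v (inl B))) = weight f (inr B).
Proof.
rewrite /weight val_old_edge big_imset /=; last by move=> x y _ _ [].
by apply: eq_bigr => u _; rewrite attach_labelingE.
Qed.

Lemma weight_new_edge i : weight g (inr (attach_edge v (inr i))) = high i.
Proof.
rewrite /weight val_new_edge big_setU1 ?inE // big_set1 !attach_labelingE /=.
by rewrite fv addnC.
Qed.

Lemma weight_vertexE (x : Gv) : weight g (inl x) =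
  \sum_(B | x \in val (attach_edge v (inl B))) f (inr B)
  + \sum_(i | x \in val (attach_edge v (inr i))) high (ordS i).
Proof.
rewrite /weight (reindex (@attach_edge G v n)) /=; last first.
  by apply: onW_bij; exists (@detach_edge _ v n); [apply: attach_edgeK|apply: detach_edgeK].
rewrite big_sumType; congr (_ + _); apply: eq_bigr => i _.
  by rewrite attach_labelingE attach_label_edge.
by rewrite attach_labelingE attach_label_edge.
Qed.

Lemma weight_new_vertex i : weight g (inl (inr i)) = high (ordS i).
Proof.
rewrite weight_vertexE big_pred0 => [|B]; last exact: new_in_old.
by rewrite (big_pred1 i) // => j; rewrite new_in_new eq_sym.
Qed.

Lemma weight_old_vertex u : weight g (inl (inl u)) =
  weight f (inl u) + (u == v) * \sum_(i < n) high i.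
Proof.
rewrite weight_vertexE; congr (_ + _).
  by apply: eq_bigl => B; rewrite old_in_old.
rewrite (eq_bigl (fun=> u == v)) => [|i]; last by rewrite old_in_new.
case: eqP => _; last by rewrite big_pred0_eq.
(* [ordS] permutes the indices, so the shift disappears from the sum. *)
by rewrite mul1n [RHS](reindex _ (onW_bij _ (ordS_bij n))).
Qed.

(** A cyclic shift of at least two indices has no fixed point; this separates each new vertex from
    its edge. *)
Lemma ordS_neq (i : 'I_n) : ordS i != i.
Proof.
rewrite -val_eqE /=; have [lt_in|ge_in] := ltnP i.+1 n.
  by rewrite modn_small // neq_ltn ltnSn orbT.
have -> : i.+1 = n by apply/eqP; rewrite eqn_leq ge_in ltn_ord.
by rewrite modnn; lia.
Qed.

(** The sum has a second positive term, at [ordS i]. Hence the new weight of [v] exceeds every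
    [high i]. *)
Lemma high_lt_sum (i : 'I_n) : high i < \sum_(j < n) high j.
Proof.
rewrite (bigD1 i) //= (bigD1 (ordS i)) ?ordS_neq //= addnA.
by have := high_gt N k (ordS i); rewrite /=; lia.
Qed.

Lemma weight_lt_high (B : edge G) (i : nat) : v \in val B -> weight f (inr B) < high i.
Proof.
move=> /(weight_adj_edge_le f); rewrite fv addnC => le_B.
exact: leq_ltn_trans le_B (high_gt _ _ _).
Qed.

(** * The antimagic conditions for the extended labeling *)

Hypothesis v_sep : forall x : G, adj v x ->
  weight f (inl v) + \sum_(i < n) high i <> weight f (inl x).

Lemma attach_vertices (x y : Gv) :
  adj x y -> weight g (inl x) != weight g (inl y).
Proof.
have v_new i : weight g (inl (inl v)) != weight g (inl (inr i)).
  rewrite weight_old_vertex weight_new_vertex eqxx mul1n.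
  by have := high_lt_sum (ordS i); lia.
case: x y => [u|i] [w|j]; rewrite [adj _ _]/=; [move=> uw|move/eqP->|move/eqP->|] => //; last by rewrite eq_sym.
have uNw := adj_neq uw; rewrite !weight_old_vertex.
have [eu|_] := eqVneq u v; have [ew|_] := eqVneq w v; rewrite ?mul1n ?mul0n ?addn0.
- by rewrite eu ew eqxx in uNw.
- by subst u; apply/eqP/v_sep.
- by subst w; rewrite eq_sym; apply/eqP/v_sep; rewrite adj_sym.
- exact: lta_vertices.
Qed.

Lemma attach_edges (A B : edge Gv) x : A != B -> x \in val A -> x \in val B ->
  weight g (inr A) != weight g (inr B).
Proof.
(* An old and a new edge can only meet at [v]. *)
have old_new C i : x \in val (attach_edge v (inl C)) ->
    x \in val (attach_edge v (inr i)) -> weight f (inr C) < high i.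
  case: x => [u|j]; last by rewrite new_in_old.
  by rewrite old_in_old old_in_new => + /eqP eu; rewrite eu; apply: weight_lt_high.
rewrite -(detach_edgeK A) -(detach_edgeK B).
case: (detach_edge A) (detach_edge B) => [C|i] [D|j] AB xA xB;
  rewrite ?weight_old_edge ?weight_new_edge.
- case: x xA xB {old_new} => [u|j]; last by rewrite new_in_old.
  rewrite !old_in_old; apply: lta_edges => //.
  by apply: contraNneq AB => ->.
- by rewrite ltn_eqF // old_new.
- by rewrite gtn_eqF // old_new.
- apply: contraNneq AB => /(high_inj k_gt0)/val_inj->; exact: eqxx.
Qed.

Lemma attach_incident (x : Gv) (A : edge Gv) : x \in val A ->
  weight g (inl x) != weight g (inr A).
Proof.
rewrite -(detach_edgeK A); case: (detach_edge A) x => [B|i] [u|j].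
- rewrite old_in_old weight_old_edge weight_old_vertex.
  have [->|_] := eqVneq u v => uB; last by rewrite mul0n addn0 lta_incident.
  (* Any [high i0] lies strictly between the weight of an old edge at [v] and the new weight of
     [v]. *)
  have i0 : 'I_n by exists 0; lia.
  by have := weight_lt_high i0 uB; have := high_lt_sum i0; rewrite mul1n; lia.
- by rewrite new_in_old.
- rewrite old_in_new weight_new_edge weight_old_vertex => ->.
  by have := high_lt_sum i; rewrite mul1n; lia.
- rewrite new_in_new weight_new_vertex weight_new_edge => /eqP->.
  by apply: contraNneq (ordS_neq i) => /(high_inj k_gt0)/val_inj->.
Qed.

Lemma attach_lta : local_total_antimagic g.
Proof.
apply/and4P; split; first exact: attach_is_labeling.
- apply/forallP=> x; apply/forallP=> y; apply/implyP; exact: attach_vertices.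
- apply/forallP=> A; apply/forallP=> B; apply/implyP=> /andP[AB /set0Pn[x]].
  by rewrite inE => /andP[]; apply: attach_edges.
- apply/forallP=> x; apply/forallP=> A; apply/implyP; exact: attach_incident.
Qed.

(** * Counting the weights of the extended labeling *)

Lemma attach_weightP y : [\/ y = inl (inl v),
  exists2 x, x != inl v & weight g y = weight f x |
  exists i : 'I_n, weight g y = high i].
Proof.
case: y => [[u|i]|A].
- have [->|uv] := eqVneq u v; first by constructor 1.
  constructor 2; exists (inl u); first by apply: contraNneq uv => -[->].
  by rewrite weight_old_vertex (negbTE uv) mul0n addn0.
- by constructor 3; exists (ordS i); rewrite weight_new_vertex.
rewrite -(detach_edgeK A); case: (detach_edge A) => [B|i].
- by constructor 2; exists (inr B); rewrite ?weight_old_edge.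
- by constructor 3; exists i; rewrite weight_new_edge.
Qed.

Local Notation new_weights := (weight g (inl (inl v)) :: [seq high i | i : 'I_n]).

Lemma size_new_weights : size new_weights = n.+1.
Proof. by rewrite /= size_map -cardE card_ord. Qed.

Lemma num_weights_attach : num_weights g <= num_weights f + n.+1.
Proof.
rewrite -size_new_weights -size_cat; apply: num_weights_le => y.
rewrite mem_cat inE; case: (attach_weightP y) => [->|[x _ ->]|[i ->]].
- by rewrite eqxx orbT.
- by rewrite mem_weights.
- by rewrite (image_f (fun i : 'I_n => high i)) ?orbT.
Qed.

(** Serves both alternatives of (c): the weight of [x0] can be struck from the old list, since any
    element other than [v] still carrying it has a weight already listed as some [high i]. *)
Lemma num_weights_attach_lost x0 :
  (forall x, x != inl v -> weight f x = weight f x0 ->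
     exists i : 'I_n, weight f x0 = high i) ->
  num_weights g <= num_weights f + n.
Proof.
move=> lost; have mem0 := mem_weights f x0.
have pos : 0 < num_weights f by rewrite /num_weights; case: (undup _) mem0.
have -> : num_weights f + n =
    size (rem (weight f x0) (undup [seq weight f x | x : elem G]) ++ new_weights).
  by rewrite size_cat size_new_weights size_rem // -/(num_weights f); lia.
apply: num_weights_le => y.
rewrite mem_cat inE mem_rem_uniq ?undup_uniq // inE.
have highP (i : 'I_n) : high i \in [seq high i | i : 'I_n].
  exact: (image_f (fun i : 'I_n => high i)).
case: (attach_weightP y) => [->|[x xv ->]|[i ->]].
- by rewrite eqxx orbT.
- have [e|_] := eqVneq (weight f x) (weight f x0); last by rewrite mem_weights.
  by have [i e'] := lost x xv e; rewrite e e' highP !orbT.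
- by rewrite highP ?orbT.
Qed.

End AttachLabeling.

(** * The bounds on [chi_lt] of the extended graph *)

Theorem theorem2p4 (k s : nat) (hk : 1 <= k) (hs : 1 <= s) (hks : 2 <= k * s)
  (G : sgraph) (hG : admissible G)
  (p q d : nat) (hp : gorder G = p) (hq : gsize G = q)
  (hd : #|pendant_edges G| = d)
  (t : nat) (f : labeling G) (v : G)
  (ha_chi : chi_lt G = t) (ha_t : t = max_degree G + 1)
  (ha_f : local_total_antimagic f) (ha_num : num_weights f = t)
  (ha_deg : degree v = max_degree G) (ha_k : f (inl v) = k :> nat)
  (hb : forall x : G, adj v x ->
     weight f (inl v)
       + \sum_(1 <= j < s.+1) \sum_(1 <= i < k.+1) (p + q + 2 * j * k + 1 - i)
     <> weight f (inl x)) :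
  let Gv := attach_pendant v (k * s) in
  (max_degree Gv + 1 <= chi_lt Gv /\ chi_lt Gv <= max_degree Gv + 2) /\
  ((forall x : elem G, weight f x = weight f (inl v) -> x = inl v) \/
   (exists x : elem G, ~~ is_pendant_vertex x /\
      exists j i : nat, [/\ 1 <= j <= s, 1 <= i <= k &
        weight f x = p + q + (2 * j - 1) * k + i]) ->
   chi_lt Gv = max_degree Gv + 1).
Proof.
move=> Gv; subst p q.
have maxE : max_degree Gv = max_degree G + k * s.
  by apply: max_degree_attach => //; lia.
have sep x : adj v x -> weight f (inl v)
    + \sum_(i < k * s) high (gorder G + gsize G) k i <> weight f (inl x).
  by rewrite sum_high //; apply: hb.
have gP := attach_lta hk hks ha_f ha_k sep.
(* In [Gv] the vertex [v] has degree [max_degree G + k * s], which is the maximum degree. *)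
have lower : max_degree Gv + 1 <= chi_lt Gv.
  rewrite maxE -ha_deg addn1.
  by have := degree_lt_chi_lt (inl v : Gv) gP; rewrite degree_old eqxx mul1n.
have upper := chi_lt_le gP.
split; first split => //.
  apply: leq_trans upper (leq_trans (num_weights_attach hk hks ha_f ha_k) _).
  by lia.
move=> hc; apply/eqP; rewrite eqn_leq lower andbT.
apply: (leq_trans upper).
suff : num_weights (attach_labeling v k s f) <= num_weights f + k * s by lia.
case: hc => [v_only|[x [_ [j [i [hj hi wx]]]]]].
  (* The old weight of [v] has no other carrier, so the condition to check is vacuous. *)
  apply: (num_weights_attach_lost hk hks ha_f ha_k (x0 := inl v)) => // x xv /v_only xE.
  by rewrite xE eqxx in xv.
(* Here the old weight of [x] is itself some [high l]. *)
apply: (num_weights_attach_lost hk hks ha_f ha_k (x0 := x)) => // _ _ _.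
have [l lE] := exists_high (gorder G + gsize G) hk hj hi.
by exists l; rewrite wx lE.
Qed.
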